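(* Let $g=(g_1,g_2)$ be a vector field with components $g_i\in C_c^2(D_1)$, $i=1,2$. (a) If $f$ is a symmetric $2$-tensor field of the form $f=\mathrm{d}g$, then $f$ can be recovered explicitly in terms of $\mathcal{L}f$ and $\mathcal{M}f$; in particular, $f$ is uniquely determined, among fields of this form, by the pair of functions $(\mathcal{L}f,\mathcal{M}f)$ on $\mathbb{R}^2$. (b) If $f$ is a symmetric $2$-tensor field of the form $f=\mathrm{d}^\perp g$, then $f$ can be recovered explicitly in terms of $\mathcal{T}f$ and $\mathcal{M}f$; in particular, $f$ is uniquely determined, among fields of this form, by the pair of functions $(\mathcal{T}f,\mathcal{M}f)$ on $\mathbb{R}^2$.
   Context: $D_1\subset\mathbb{R}^2$ is an open disc of radius $r_1>0$ centered at the origin; $C_c^2(D_1)$ is the space of twice continuously differentiable functions with compact support in $D_1$ (extended by zero to $\mathbb{R}^2$). For a vector field $g=(g_1,g_2)$, $\mathrm{d}g$ and $\mathrm{d}^\perp g$ are the symmetric $2$-tensor fields $$(\mathrm{d}g)_{ij}=\tfrac12\left(\tfrac{\partial g_i}{\partial x_j}+\tfrac{\partial g_j}{\partial x_i}\right),\qquad (\mathrm{d}^\perp g)_{ij}=\tfrac12\left((-1)^j\tfrac{\partial g_i}{\partial x_{3-j}}+(-1)^i\tfrac{\partial g_j}{\partial x_{3-i}}\right).$$ For symmetric $2$-tensors, $\langle f,h\rangle=f_{11}h_{11}+2f_{12}h_{12}+f_{22}h_{22}$. For vectors $a,b\in\mathbb{R}^2$, $(a\odot b)_{ij}=\frac12(a_ib_j+a_jb_i)$,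 $a^2=a\odot a$, $a^\perp=(-a_2,a_1)$. For a unit vector $a$ and a compactly supported function $h$, $\mathcal{X}_a h(x)=\int_0^\infty h(x+ta)\,dt$. Fix unit vectors $u=(u_1,u_2)$ and $v=(-u_1,u_2)$ that are linearly independent (so $u_1u_2\neq0$, i.e. $-1<u_1^2-u_2^2<1$). For a continuous compactly supported symmetric $2$-tensor field $f$, the longitudinal, transverse and mixed V-line transforms are the functions on $\mathbb{R}^2$ $$\mathcal{L}f=\mathcal{X}_u\langle f,u^2\rangle+\mathcal{X}_v\langle f,v^2\rangle,\quad \mathcal{T}f=\mathcal{X}_u\langle f,(u^\perp)^2\rangle+\mathcal{X}_v\langle f,(v^\perp)^2\rangle,\quad \mathcal{M}f=\mathcal{X}_u\langle f,u\odot u^\perp\rangle+\mathcal{X}_v\langle f,v\odot v^\perp\rangle.$$ (Their values on a sufficiently large closed disc centered at the origin determine them on all of $\mathbb{R}^2$.) *)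

(* Defs.v *)
From Stdlib Require Import Reals Lra.
From Coquelicot Require Import Coquelicot.
Open Scope R_scope.

Inductive axis := ax1 | ax2.

Definition num (i : axis) : nat := match i with ax1 => 1 | ax2 => 2 end.

(* the index 3 - i *)
Definition other (i : axis) : axis := match i with ax1 => ax2 | ax2 => ax1 end.

Definition point := (R * R)%type.
Definition coord (i : axis) (x : point) : R :=
  match i with ax1 => fst x | ax2 => snd x end.

Definition scalar_field := point -> R.
Definition vector_field := point -> point.

Definition tensor := axis -> axis -> R.
Definition tensor_field := point -> tensor.

Definition along (x a : point) (t : R) : point :=
  (fst x + t * fst a, snd x + t * snd a).

Definition basis (i : axis) : point :=
  match i with ax1 => (1, 0) | ax2 => (0, 1) end.

Definition ddir (a : point) (h : scalar_field) : scalar_field :=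
  fun x => Derive (fun t => h (along x a t)) 0.

Definition ex_ddir (a : point) (h : scalar_field) (x : point) : Prop :=
  ex_derive (fun t => h (along x a t)) 0.

Definition partial (i : axis) (h : scalar_field) : scalar_field :=
  ddir (basis i) h.

Fixpoint class_C (k : nat) (h : scalar_field) : Prop :=
  (forall x : point, continuous h x) /\
  match k with
  | O => True
  | S k' => forall i : axis,
      (forall x : point, ex_ddir (basis i) h x) /\ class_C k' (partial i h)
  end.

Definition disc (r : R) (x : point) : Prop := (fst x) ^ 2 + (snd x) ^ 2 < r ^ 2.

(* the closure of the set where h does not vanish *)
Definition supp (h : scalar_field) (x : point) : Prop :=
  forall P : point -> Prop, locally x P -> exists y : point, P y /\ h y <> 0.

(* C_c^2 of the open disc of radius r, each function being identified with its
   extension by zero to the plane.  [supp h] is closed, so once it is contained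
   in the (bounded) disc it is compact. *)
Definition C2c (r : R) (h : scalar_field) : Prop :=
  class_C 2 h /\ forall x : point, supp h x -> disc r x.

Definition component (i : axis) (g : vector_field) : scalar_field :=
  fun x => coord i (g x).

Definition C2c_field (r : R) (g : vector_field) : Prop :=
  forall i : axis, C2c r (component i g).

Definition d (g : vector_field) : tensor_field := fun x i j =>
  / 2 * (partial j (component i g) x + partial i (component j g) x).

Definition dperp (g : vector_field) : tensor_field := fun x i j =>
  / 2 * ((-1) ^ (num j) * partial (other j) (component i g) x
         + (-1) ^ (num i) * partial (other i) (component j g) x).

Definition inner (f h : tensor) : R :=
  f ax1 ax1 * h ax1 ax1 + 2 * (f ax1 ax2 * h ax1 ax2) + f ax2 ax2 * h ax2 ax2.

Definition sym_prod (a b : point) : tensor := fun i j =>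
  / 2 * (coord i a * coord j b + coord j a * coord i b).

Definition sq (a : point) : tensor := sym_prod a a.

Definition perp (a : point) : point := (- snd a, fst a).

Definition contract (f : tensor_field) (h : tensor) : scalar_field :=
  fun x => inner (f x) h.

Definition int_0_infty (phi : R -> R) : R :=
  RInt_gen phi (at_point 0) (Rbar_locally p_infty).

Definition beam (a : point) (h : scalar_field) : scalar_field :=
  fun x => int_0_infty (fun t => h (along x a t)).

Definition unit_vector (a : point) : Prop := (fst a) ^ 2 + (snd a) ^ 2 = 1.

Definition lin_indep (a b : point) : Prop := forall s t : R,
  s * fst a + t * fst b = 0 -> s * snd a + t * snd b = 0 -> s = 0 /\ t = 0.

(* the second branch direction v = (- u_1, u_2) *)
Definition mirror (u : point) : point := (- fst u, snd u).

Definition Ltrans (u : point) (f : tensor_field) : scalar_field := fun x =>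
  let v := mirror u in
  beam u (contract f (sq u)) x + beam v (contract f (sq v)) x.

Definition Ttrans (u : point) (f : tensor_field) : scalar_field := fun x =>
  let v := mirror u in
  beam u (contract f (sq (perp u))) x + beam v (contract f (sq (perp v))) x.

Definition Mtrans (u : point) (f : tensor_field) : scalar_field := fun x =>
  let v := mirror u in
  beam u (contract f (sym_prod u (perp u))) x
  + beam v (contract f (sym_prod v (perp v))) x.

(* An explicit formula for the compactly supported solution w of
     2 u_1^2 w_11 + (u_1^2 - u_2^2) w_22 = h.
   With A = 2 u_1^2 > 0 and B = u_1^2 - u_2^2:
   - B > 0 (elliptic): convolution of h with the logarithmic fundamental
     solution, in polar coordinates adapted to the operator;
   - B < 0 (hyperbolic): the operator is the product of the derivatives along
     (sqrt A, sqrt (-B)) and (sqrt A, - sqrt (-B)), inverted by integrating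
     along both characteristic directions;
   - B = 0 (parabolic): two integrations in the first variable. *)
Definition solve (u : point) (h : scalar_field) : scalar_field := fun x =>
  let A := 2 * (fst u) ^ 2 in
  let B := (fst u) ^ 2 - (snd u) ^ 2 in
  match total_order_T B 0 with
  | inleft (left _) =>
      beam (sqrt A, sqrt (- B)) (beam (sqrt A, - sqrt (- B)) h) x
  | inleft (right _) =>
      / A * int_0_infty (fun t => t * h (along x (1, 0) t))
  | inright _ =>
      / (2 * PI) * int_0_infty (fun r => r * ln r *
        RInt (fun theta => h (along x (sqrt A * cos theta, sqrt B * sin theta) r))
             0 (2 * PI))
  end.

(* Recovery of f = d g from l = L f and m = M f.  One has l = - 2 u_2 g_2, and
   applying D_u D_v to m gives
     2 u_1^2 d_11 g_1 + (u_1^2 - u_2^2) d_22 g_1 = d_12 g_2 - D_u D_v m / u_2. *)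
Definition recover_d (u : point) (l m : scalar_field) : tensor_field :=
  let v := mirror u in
  let g2 := fun x => - l x / (2 * snd u) in
  let g1 := solve u (fun x =>
    partial ax1 (partial ax2 g2) x - ddir u (ddir v m) x / snd u) in
  d (fun x => (g1 x, g2 x)).

(* Recovery of f = d^perp g from s = T f and m = M f.  One has s = 2 u_2 g_1, and
     2 u_1^2 d_11 g_2 + (u_1^2 - u_2^2) d_22 g_2 = D_u D_v m / u_2 - d_12 g_1. *)
Definition recover_dperp (u : point) (s m : scalar_field) : tensor_field :=
  let v := mirror u in
  let g1 := fun x => s x / (2 * snd u) in
  let g2 := solve u (fun x =>
    ddir u (ddir v m) x / snd u - partial ax1 (partial ax2 g1) x) in
  dperp (fun x => (g1 x, g2 x)).

Definition of_form (op : vector_field -> tensor_field) (r : R) (f : tensor_field)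
  : Prop :=
  exists g : vector_field,
    C2c_field r g /\ forall x i j, f x i j = op g x i j.

(* Main.v *)
Require Import Defs.
From Stdlib Require Import Reals Lra FunctionalExtensionality.
From Coquelicot Require Import Coquelicot.
Open Scope R_scope.

(** Along a ray in direction [a], the beam transform is integration to infinity, so
    on fields vanishing far away it inverts the directional derivative up to sign
    ([beam_ddir], [is_derive_beam_same]), and it commutes with derivatives in other
    directions ([is_derive_beam_other]).

    For f = d g one has <f, a^2> = D_a (a . g), hence L f = - (u + v) . g, which is
    - 2 u_2 g_2 because the first components of u and v cancel: the data L f
    contain g_2.  The mixed transform is not integrated so directly, but D_u D_v
    removes both beams at once ([ddir_ddir_vline]) and turns M f into a first order
    differential expression in f ([ddir_ddir_Mtrans]).  For f = d g this expression
    consists of 2 u_1^2 d_11 g_1 + (u_1^2 - u_2^2) d_22 g_1 and of a mixed derivative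
    of the known g_2.  The field d^perp g behaves in the same way with the
    roles of g_1 and g_2 exchanged, since <f, (a^perp)^2> = D_a (a^perp . g).

    What remains is to solve A d_11 w + B d_22 w = h for w of compact support, where
    A = 2 u_1^2 > 0 and B = u_1^2 - u_2^2 ([solve_correct]).  For B < 0 the operator
    factors into two directional derivatives, each inverted by a beam; for B = 0 one
    integrates t w'' by parts.  For B > 0 the logarithmic potential is evaluated in
    elliptic polar coordinates ([log_potential]): with m(r) the integral of w over the
    angle and H(r) that of h, one has (r m')' = r H, because the angular part of the
    operator is an exact derivative in the angle.  Hence r ln r H is the derivative of
    r ln r m' - m, whose value at infinity is zero and at the centre is - 2 pi w(x).
    Uniqueness follows since the reconstruction depends on the data alone
    ([recovery_unique]). *)

(** * Continuity and differentiation of fields along curves *)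

Lemma continuous_Rplus (U : UniformSpace) (f g : U -> R) (x : U) :
  continuous f x -> continuous g x -> continuous (fun y => f y + g y) x.
Proof. exact (continuous_plus (V := R_NormedModule) f g x). Qed.

Lemma continuous_Rmult (U : UniformSpace) (f g : U -> R) (x : U) :
  continuous f x -> continuous g x -> continuous (fun y => f y * g y) x.
Proof. exact (continuous_mult (K := R_AbsRing) f g x). Qed.

Lemma continuous_Ropp (U : UniformSpace) (f : U -> R) (x : U) :
  continuous f x -> continuous (fun y => - f y) x.
Proof. exact (continuous_opp (V := R_NormedModule) f x). Qed.

Lemma continuous_fst_of (U : UniformSpace) (f : U -> R * R) (x : U) :
  continuous f x -> continuous (fun y => fst (f y)) x.
Proof. intros Hf; apply continuous_comp; [exact Hf | apply continuous_fst]. Qed.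

Lemma continuous_snd_of (U : UniformSpace) (f : U -> R * R) (x : U) :
  continuous f x -> continuous (fun y => snd (f y)) x.
Proof. intros Hf; apply continuous_comp; [exact Hf | apply continuous_snd]. Qed.

Lemma continuous_Rpair (U : UniformSpace) (f g : U -> R) (x : U) :
  continuous f x -> continuous g x -> continuous (fun y => (f y, g y)) x.
Proof.
intros Hf Hg; apply (continuous_comp_2 f g (fun a b => (a, b))); auto.
apply (continuous_ext (fun z : R * R => z)); [now intros [a b] | apply continuous_id].
Qed.

Lemma continuous_along (U : UniformSpace) (x a : U -> point) (t : U -> R) (p : U) :
  continuous x p -> continuous a p -> continuous t p ->
  continuous (fun q => along (x q) (a q) (t q)) p.
Proof.
intros Hx Ha Ht; unfold along; apply continuous_Rpair; apply continuous_Rplus;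
  try apply continuous_Rmult; auto using continuous_fst_of, continuous_snd_of.
Qed.

(** The rule is chosen by the syntactic form of the function, which keeps unification
    from unfolding the fields. *)
Ltac continuity_rules :=
  lazymatch goal with
  | |- forall _, _ => intro; continuity_rules
  | |- continuous ?f _ =>
    lazymatch f with
    | fun _ => ?c => apply continuous_const
    | fun q => q => apply continuous_id
    | fun q => @?g q + @?h q => apply (continuous_Rplus _ g h); continuity_rules
    | fun q => @?g q * @?h q => apply (continuous_Rmult _ g h); continuity_rules
    | fun q => - @?g q => apply (continuous_Ropp _ g); continuity_rules
    | fun q => cos (@?g q) =>
        apply (continuous_comp g cos); [continuity_rules | apply continuous_cos]
    | fun q => sin (@?g q) =>
        apply (continuous_comp g sin); [continuity_rules | apply continuous_sin]
    | fun q => fst (@?g q) => apply (continuous_fst_of _ g); continuity_rules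
    | fun q => snd (@?g q) => apply (continuous_snd_of _ g); continuity_rules
    | fun q => (@?g q, @?h q) => apply (continuous_Rpair _ g h); continuity_rules
    | fun q => along (@?x q) (@?a q) (@?t q) =>
        apply (continuous_along _ x a t); continuity_rules
    | fun q => ?h (@?g q) => apply (continuous_comp g h); [continuity_rules | auto]
    | _ => auto
    end
  end.

Lemma class_C_continuous (k : nat) (h : scalar_field) :
  class_C k h -> forall x, continuous h x.
Proof. destruct k; simpl; tauto. Qed.

Lemma class_C_partial (k : nat) (i : axis) (h : scalar_field) :
  class_C (S k) h -> class_C k (partial i h).
Proof. intros [_ H]; apply H. Qed.

Lemma class_C_ex_partial (k : nat) (i : axis) (h : scalar_field) :
  class_C (S k) h -> forall x, ex_ddir (basis i) h x.
Proof. intros [_ H]; apply H. Qed.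

Lemma class_C_pred (k : nat) : forall h, class_C (S k) h -> class_C k h.
Proof.
induction k as [|k IH]; intros h H; split; [| easy | | ].
1, 2: eapply class_C_continuous; exact H.
intros i; split.
- exact (class_C_ex_partial _ i h H).
- exact (IH _ (class_C_partial _ i h H)).
Qed.

Lemma is_derive_partial_1 (h : scalar_field) (x y : R) :
  ex_ddir (basis ax1) h (x, y) ->
  is_derive (fun z => h (z, y)) x (partial ax1 h (x, y)).
Proof.
intros H; unfold partial, ddir.
apply Derive_correct in H.
set (l := Derive _ _) in *.
apply (is_derive_ext (fun z => h (along (x, y) (basis ax1) (z - x)))).
- intros z; unfold along; simpl; f_equal; f_equal; ring.
- replace l with (scal 1 l) by apply (scal_one l).
  apply (is_derive_comp (fun t => h (along (x, y) (basis ax1) t)) (fun z => z - x)).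
  + now rewrite Rminus_diag.
  + auto_derive; [easy | ring].
Qed.

Lemma is_derive_partial_2 (h : scalar_field) (x y : R) :
  ex_ddir (basis ax2) h (x, y) ->
  is_derive (fun z => h (x, z)) y (partial ax2 h (x, y)).
Proof.
intros H; unfold partial, ddir.
apply Derive_correct in H.
set (l := Derive _ _) in *.
apply (is_derive_ext (fun z => h (along (x, y) (basis ax2) (z - y)))).
- intros z; unfold along; simpl; f_equal; f_equal; ring.
- replace l with (scal 1 l) by apply (scal_one l).
  apply (is_derive_comp (fun t => h (along (x, y) (basis ax2) t)) (fun z => z - y)).
  + now rewrite Rminus_diag.
  + auto_derive; [easy | ring].
Qed.

(** The chain rule. Partial derivatives alone do not give it; continuity of one of
    them does, by the mean value theorem. *)
Lemma is_derive_field_comp (h : scalar_field) (y1 y2 : R -> R) (t l1 l2 : R) :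
  class_C 1 h -> is_derive y1 t l1 -> is_derive y2 t l2 ->
  is_derive (fun s => h (y1 s, y2 s)) t
    (partial ax1 h (y1 t, y2 t) * l1 + partial ax2 h (y1 t, y2 t) * l2).
Proof.
intros Hh H1 H2.
apply is_derive_Reals in H1; apply is_derive_Reals in H2; apply is_derive_Reals.
apply (derivable_pt_lim_comp_2d (fun a b => h (a, b)) y1 y2 t); auto.
apply filterdiff_differentiable_pt_lim.
apply (is_derive_filterdiff (fun a b => h (a, b)) (y1 t) (y2 t)
         (fun a b => partial ax1 h (a, b))).
- apply filter_forall; intros [a b].
  apply is_derive_partial_1, (class_C_ex_partial 0), Hh.
- apply is_derive_partial_2, (class_C_ex_partial 0), Hh.
- pose proof (class_C_continuous _ _ (class_C_partial 0 ax1 h Hh)) as Hc.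
  apply (continuous_ext (partial ax1 h)); [now intros [a b] | apply Hc].
Qed.

Lemma is_derive_along (h : scalar_field) (x a : point) (t : R) :
  class_C 1 h ->
  is_derive (fun s => h (along x a s)) t
    (fst a * partial ax1 h (along x a t) + snd a * partial ax2 h (along x a t)).
Proof.
intros Hh; unfold along; evar_last.
- apply (is_derive_field_comp h (fun s => fst x + s * fst a)
           (fun s => snd x + s * snd a) t (fst a) (snd a) Hh);
    auto_derive; auto; ring.
- simpl; ring.
Qed.

Lemma along_0 (x a : point) : along x a 0 = x.
Proof. destruct x; unfold along; simpl; f_equal; ring. Qed.

Lemma along_along (x a : point) (s t : R) : along (along x a s) a t = along x a (s + t).
Proof. unfold along; simpl; f_equal; ring. Qed.

Lemma ddir_is_derive (a : point) (h : scalar_field) (x : point) (l : R) :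
  is_derive (fun t => h (along x a t)) 0 l -> ddir a h x = l.
Proof. apply is_derive_unique. Qed.

Lemma ddir_partial (a : point) (h : scalar_field) :
  class_C 1 h ->
  ddir a h = fun x => fst a * partial ax1 h x + snd a * partial ax2 h x.
Proof.
intros Hh; apply functional_extensionality; intros x.
apply ddir_is_derive.
pose proof (is_derive_along h x a 0 Hh) as H; now rewrite along_0 in H.
Qed.

Lemma is_derive_along_ddir (h : scalar_field) (x a : point) (t : R) :
  class_C 1 h -> is_derive (fun s => h (along x a s)) t (ddir a h (along x a t)).
Proof. intros Hh; rewrite ddir_partial by easy; now apply is_derive_along. Qed.

Lemma partial_lin (i : axis) (h k : scalar_field) (c e : R) :
  (forall x, ex_ddir (basis i) h x) -> (forall x, ex_ddir (basis i) k x) ->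
  partial i (fun x => c * h x + e * k x)
    = fun x => c * partial i h x + e * partial i k x.
Proof.
intros Hh Hk; apply functional_extensionality; intros x; unfold partial, ddir.
rewrite Derive_plus.
- now rewrite !Derive_scal.
- apply ex_derive_scal, Hh.
- apply ex_derive_scal, Hk.
Qed.

Lemma class_C_lin (k : nat) (c e : R) : forall h h',
  class_C k h -> class_C k h' -> class_C k (fun x => c * h x + e * h' x).
Proof.
induction k as [|k IH]; intros h h' Hh Hh'; split.
1, 3: intros x; apply continuous_Rplus; apply continuous_Rmult;
  try apply continuous_const; eapply class_C_continuous; eassumption.
- easy.
- intros i; split.
  + intros x. apply @ex_derive_plus; apply ex_derive_scal;
      apply (class_C_ex_partial k); easy.
  + rewrite partial_lin by now apply (class_C_ex_partial k).
    apply IH; now apply class_C_partial.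
Qed.

Lemma class_C_S_1 (k : nat) (h : scalar_field) : class_C (S k) h -> class_C 1 h.
Proof. induction k; [easy | intros Hh; now apply IHk, class_C_pred]. Qed.

Lemma class_C_ddir (k : nat) (a : point) (h : scalar_field) :
  class_C (S k) h -> class_C k (ddir a h).
Proof.
intros Hh; rewrite ddir_partial by now apply (class_C_S_1 k).
apply class_C_lin; now apply class_C_partial.
Qed.

(** Symmetry of second derivatives, transported to [partial] from the two-variable
    form of the theorem of Schwarz. *)
Lemma partial_comm (h : scalar_field) :
  class_C 2 h -> partial ax1 (partial ax2 h) = partial ax2 (partial ax1 h).
Proof.
intros Hh; apply functional_extensionality; intros [x y].
pose proof (fun i => class_C_partial 1 i h Hh) as Hp.
assert (D1 : forall k, class_C 1 k -> forall a b,
          is_derive (fun z => k (z, b)) a (partial ax1 k (a, b))).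
{ intros; now apply is_derive_partial_1, (class_C_ex_partial 0). }
assert (D2 : forall k, class_C 1 k -> forall a b,
          is_derive (fun z => k (a, z)) b (partial ax2 k (a, b))).
{ intros; now apply is_derive_partial_2, (class_C_ex_partial 0). }
pose proof (class_C_pred 1 h Hh) as Hh1.
assert (E12 : forall a b,
  Derive (fun z => Derive (fun t => h (z, t)) b) a = partial ax1 (partial ax2 h) (a, b)).
{ intros a b; apply is_derive_unique.
  eapply is_derive_ext; [|apply D1, Hp].
  intros z; symmetry; now apply is_derive_unique, D2. }
assert (E21 : forall a b,
  Derive (fun z => Derive (fun t => h (t, z)) a) b = partial ax2 (partial ax1 h) (a, b)).
{ intros a b; apply is_derive_unique.
  eapply is_derive_ext; [|apply D2, Hp].
  intros z; symmetry; now apply is_derive_unique, D1. }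
rewrite <- E12, <- E21.
assert (C : forall i j, continuity_2d_pt (fun a b => partial i (partial j h) (a, b)) x y).
{ intros i j; apply continuity_2d_pt_filterlim.
  pose proof (class_C_continuous _ _ (class_C_partial 0 i _ (Hp j))) as Hc.
  apply (continuous_ext (partial i (partial j h))); [now intros [a b] | apply Hc]. }
apply (Schwarz (fun a b => h (a, b))).
- apply locally_2d_forall; intros a b; repeat split.
  + eexists; now apply D1.
  + eexists; now apply D2.
  + eexists. eapply is_derive_ext; [|apply D1, (Hp ax2)].
    intros z; symmetry; now apply is_derive_unique, D2.
  + eexists. eapply is_derive_ext; [|apply D2, (Hp ax1)].
    intros z; symmetry; now apply is_derive_unique, D1.
- eapply continuity_2d_pt_ext; [|apply (C ax1 ax2)]. intros; symmetry; apply E12.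
- eapply continuity_2d_pt_ext; [|apply (C ax2 ax1)]. intros; symmetry; apply E21.
Qed.

(** * Fields vanishing far from the origin *)

(** The bound is on the coordinates, so that only absolute values have to be
    estimated along rays and ellipses. *)
Definition vanishes_far (h : scalar_field) : Prop :=
  exists M, forall x, M < Rabs (fst x) \/ M < Rabs (snd x) -> h x = 0.

Lemma C2c_vanishes_far (r : R) (h : scalar_field) : C2c r h -> vanishes_far h.
Proof.
intros [_ Hs]; exists (Rabs r); intros x Hx.
destruct (Req_dec (h x) 0) as [|Hn]; [easy|exfalso].
assert (Hd : Defs.disc r x).
{ apply Hs; intros P HP; exists x; split; [now apply locally_singleton | easy]. }
unfold Defs.disc in Hd; rewrite <- (pow2_abs r), <- (pow2_abs (fst x)), <- (pow2_abs (snd x)) in Hd.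
pose proof (Rabs_pos r).
destruct Hx; nra.
Qed.

Lemma locally_0_unit (P : R -> Prop) :
  (forall t, Rabs t < 1 -> P t) -> locally 0 P.
Proof.
intros H; exists (mkposreal 1 Rlt_0_1); intros t Ht; apply H.
change (Rabs (t - 0) < 1) in Ht; now rewrite Rminus_0_r in Ht.
Qed.

Lemma vanishes_far_partial (i : axis) (h : scalar_field) :
  vanishes_far h -> vanishes_far (partial i h).
Proof.
intros [M HM]; exists (M + 1); intros x Hx.
unfold partial, ddir.
transitivity (Derive (fun _ => 0) 0); [|apply Derive_const].
apply Derive_ext_loc, locally_0_unit; intros t Ht; apply HM.
unfold along; destruct i, Hx as [Hx|Hx]; simpl; [left|right|left|right];
  (unfold Rabs in *; repeat destruct Rcase_abs; lra).
Qed.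

Lemma vanishes_far_lin (c e : R) (h k : scalar_field) :
  vanishes_far h -> vanishes_far k -> vanishes_far (fun x => c * h x + e * k x).
Proof.
intros [M HM] [N HN]; exists (Rmax M N); intros x Hx.
pose proof (Rmax_l M N); pose proof (Rmax_r M N).
rewrite HM, HN; [ring | |]; destruct Hx; [left|right|left|right]; lra.
Qed.

Lemma vanishes_far_ddir (a : point) (h : scalar_field) :
  class_C 1 h -> vanishes_far h -> vanishes_far (ddir a h).
Proof.
intros Hc Hh; rewrite ddir_partial by easy.
now apply vanishes_far_lin; apply vanishes_far_partial.
Qed.

(** The time [T] serves all rays starting in a bounded set whose directions stay
    away from zero, as needed to differentiate under the integral signs. *)
Lemma vanishes_along (h : scalar_field) : vanishes_far h ->
  forall N c, 0 < c -> exists T, 0 <= T /\ forall x a t,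
    Rabs (fst x) <= N -> Rabs (snd x) <= N ->
    c <= Rabs (fst a) \/ c <= Rabs (snd a) -> T < t -> h (along x a t) = 0.
Proof.
intros [M HM] N c Hc; exists ((Rabs M + Rabs N) / c).
assert (HT : 0 <= (Rabs M + Rabs N) / c).
{ apply Rle_mult_inv_pos; [|easy].
  pose proof (Rabs_pos M); pose proof (Rabs_pos N); lra. }
split; [easy|].
intros x a t H1 H2 Ha Ht; apply HM; unfold along; simpl.
assert (Htc : Rabs M + Rabs N < t * c).
{ apply (Rmult_lt_compat_r c) in Ht; [|easy].
  unfold Rdiv in Ht; rewrite Rmult_assoc, Rinv_l, Rmult_1_r in Ht; lra. }
assert (E : forall p q, Rabs p <= N -> c <= Rabs q -> M < Rabs (p + t * q)).
{ intros p q Hp Hq.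
  pose proof (Rabs_triang_inv (t * q) (- p)) as Htr.
  rewrite Rabs_Ropp, Rabs_mult, (Rabs_pos_eq t) in Htr by lra.
  replace (t * q - - p) with (p + t * q) in Htr by ring.
  pose proof (Rle_abs M); pose proof (Rle_abs N).
  assert (t * c <= t * Rabs q) by (apply Rmult_le_compat_l; lra).
  lra. }
destruct Ha; [left|right]; now apply E.
Qed.

Definition nonzero_dir (a : point) : Prop := fst a <> 0 \/ snd a <> 0.

Lemma vanishes_along_near (h : scalar_field) (x v a : point) :
  vanishes_far h -> nonzero_dir a ->
  exists T, 0 <= T /\
    forall s t, Rabs s <= 1 -> T < t -> h (along (along x v s) a t) = 0.
Proof.
intros Hh Ha.
set (N := Rabs (fst x) + Rabs (snd x) + Rabs (fst v) + Rabs (snd v)).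
set (c := Rmax (Rabs (fst a)) (Rabs (snd a))).
assert (Hc : 0 < c).
{ unfold c; destruct Ha as [Ha|Ha]; apply Rabs_pos_lt in Ha;
  [apply Rlt_le_trans with (2 := Rmax_l _ _) | apply Rlt_le_trans with (2 := Rmax_r _ _)];
  easy. }
destruct (vanishes_along h Hh N c Hc) as [T [HT0 HT]].
exists T; split; [easy|]; intros s t Hs Ht.
assert (E : forall p q, Rabs (p + s * q) <= Rabs p + Rabs q).
{ intros p q; pose proof (Rabs_triang p (s * q)) as E; rewrite Rabs_mult in E.
  pose proof (Rabs_pos q); nra. }
pose proof (Rabs_pos (fst x)); pose proof (Rabs_pos (snd x));
pose proof (Rabs_pos (fst v)); pose proof (Rabs_pos (snd v)).
apply HT; auto.
- simpl; eapply Rle_trans; [apply E | unfold N; lra].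
- simpl; eapply Rle_trans; [apply E | unfold N; lra].
- unfold c, Rmax; destruct Rle_dec; [right|left]; apply Rle_refl.
Qed.

Lemma vanishes_on_ray (h : scalar_field) (x a : point) :
  vanishes_far h -> nonzero_dir a ->
  exists T, 0 <= T /\ forall t, T < t -> h (along x a t) = 0.
Proof.
intros Hh Ha.
destruct (vanishes_along_near h x a a Hh Ha) as [T [HT0 HT]].
exists T; split; [easy|]; intros t Ht.
rewrite <- (along_0 x a); apply HT; [rewrite Rabs_R0; lra | easy].
Qed.

(** * Integrals over half-lines *)

Lemma int_0_infty_eventually (phi : R -> R) (T l : R) :
  (forall b, T < b -> is_RInt phi 0 b l) -> int_0_infty phi = l.
Proof.
intros H; unfold int_0_infty; apply is_RInt_gen_unique; intros P HP.
exists (fun a => a = 0) (fun b => T < b); [reflexivity | now exists T |].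
intros a b -> Hb; exists l; split; [now apply H | now apply locally_singleton].
Qed.

Lemma is_RInt_minus_derive (F dF : R -> R) (a b : R) :
  (forall t, is_derive F t (dF t)) -> (forall t, continuous dF t) ->
  is_RInt dF a b (F b - F a).
Proof. intros HF Hc; apply (is_RInt_derive F dF); auto. Qed.

Lemma ex_RInt_cont (f : R -> R) (a b : R) :
  (forall t, continuous f t) -> ex_RInt f a b.
Proof. intros Hf; apply (ex_RInt_continuous f); auto. Qed.

Lemma is_derive_primitive (f : R -> R) (a t : R) :
  (forall s, continuous f s) -> is_derive (fun s => RInt f a s) t (f t).
Proof.
intros Hf; apply (is_derive_RInt f _ a t); [|easy].
apply filter_forall; intros s; now apply (RInt_correct f), ex_RInt_cont.
Qed.

Lemma RInt_0_on (f : R -> R) (a b : R) :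
  (forall t, Rmin a b < t < Rmax a b -> f t = 0) -> RInt f a b = 0.
Proof.
intros Hf; rewrite (RInt_ext f (fun _ => 0)) by easy.
rewrite RInt_const; apply Rmult_0_r.
Qed.

Lemma RInt_stable (f : R -> R) (T b : R) :
  (forall s, continuous f s) -> (forall t, T < t -> f t = 0) -> T < b ->
  RInt f 0 b = RInt f 0 T.
Proof.
intros Hc Hf Hb.
rewrite <- (RInt_Chasles f 0 T b) by now apply ex_RInt_cont.
rewrite (RInt_0_on f T b); [apply Rplus_0_r|].
intros t; rewrite Rmin_left by lra; intros [Ht _]; now apply Hf.
Qed.

Lemma int_0_infty_RInt (phi : R -> R) (T : R) :
  (forall s, continuous phi s) -> (forall t, T < t -> phi t = 0) ->
  int_0_infty phi = RInt phi 0 T.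
Proof.
intros Hc Hf; apply (int_0_infty_eventually phi T); intros b Hb.
rewrite <- (RInt_stable phi T b) by easy.
now apply (RInt_correct phi), ex_RInt_cont.
Qed.

Lemma is_derive_under_RInt (f df : R -> R -> R) (a b s : R) :
  (forall y t, is_derive (fun z => f z t) y (df y t)) ->
  (forall p : R * R, continuous (fun q => df (fst q) (snd q)) p) ->
  (forall y t, continuous (f y) t) ->
  is_derive (fun y => RInt (f y) a b) s (RInt (df s) a b).
Proof.
intros Hd Hc Hf.
rewrite (RInt_ext (df s) (fun t => Derive (fun z => f z t) s))
  by (intros; symmetry; now apply is_derive_unique).
apply is_derive_RInt_param.
- apply filter_forall; intros y t _; eexists; apply Hd.
- intros t _; apply (continuity_2d_pt_ext df).
  + intros; symmetry; now apply is_derive_unique.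
  + apply continuity_2d_pt_filterlim, Hc.
- apply filter_forall; intros y; now apply ex_RInt_cont.
Qed.

(** * The divergent beam transform inverts directional derivatives *)

Lemma continuous_on_ray (h : scalar_field) (x a : point) :
  (forall y, continuous h y) -> forall t, continuous (fun s => h (along x a s)) t.
Proof. intros Hh; continuity_rules. Qed.

(** The fundamental theorem of calculus on a half-line along which the field is
    eventually zero. *)
Lemma beam_ddir (a : point) (h : scalar_field) :
  class_C 1 h -> vanishes_far h -> nonzero_dir a ->
  beam a (ddir a h) = fun x => - h x.
Proof.
intros Hc Hh Ha; apply functional_extensionality; intros x.
destruct (vanishes_on_ray h x a Hh Ha) as [T [_ HT]].
apply (int_0_infty_eventually _ T); intros b Hb.
replace (- h x) with (h (along x a b) - h (along x a 0))
  by (rewrite along_0, HT by easy; ring).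
apply (is_RInt_minus_derive (fun t => h (along x a t))).
- intros t; now apply is_derive_along_ddir.
- apply continuous_on_ray, (class_C_continuous 0), class_C_ddir, Hc.
Qed.

(** Moving the vertex along the ray shortens the ray, so this is the derivative of an
    integral with respect to its lower end. *)
Lemma is_derive_beam_same (a : point) (h : scalar_field) (x : point) :
  (forall y, continuous h y) -> vanishes_far h -> nonzero_dir a ->
  is_derive (fun s => beam a h (along x a s)) 0 (- h x).
Proof.
intros Hc Hh Ha.
destruct (vanishes_on_ray h x a Hh Ha) as [T [_ HT]].
set (phi := fun t => h (along x a t)).
assert (Hphi : forall t, continuous phi t) by now apply continuous_on_ray.
apply (is_derive_ext (fun s => RInt phi 0 T - RInt phi 0 s)).
- intros s; symmetry.
  apply (int_0_infty_eventually _ (T - s)); intros b Hb.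
  apply (is_RInt_ext (fun t => phi (s + t))).
  { intros t _; unfold phi; now rewrite along_along. }
  rewrite <- (RInt_stable phi T (s + b)) by (try easy; lra).
  replace (RInt phi 0 s) with (RInt phi 0 (s + 0)) by now rewrite Rplus_0_r.
  apply (is_RInt_minus_derive (fun t => RInt phi 0 (s + t))).
  + intros t; replace (phi (s + t)) with (scal 1 (phi (s + t))) by apply (scal_one (phi (s + t))).
    apply (is_derive_comp (fun z => RInt phi 0 z) (fun t => s + t)).
    * now apply is_derive_primitive.
    * auto_derive; [easy | ring].
  + intros t; apply (continuous_comp (fun t => s + t) phi); [|apply Hphi].
    continuity_rules.
- replace (- h x) with (0 - phi 0) by (unfold phi; rewrite along_0; ring).
  apply (is_derive_minus (fun _ => RInt phi 0 T)).
  + apply (is_derive_const (RInt phi 0 T)).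
  + now apply is_derive_primitive.
Qed.

(** The beam transform commutes with translations.  For vertices near [x] all the
    integrals live on one bounded interval, where differentiation under the integral
    sign is available. *)
Lemma is_derive_beam_other (a v : point) (h : scalar_field) (x : point) :
  class_C 1 h -> vanishes_far h -> nonzero_dir a ->
  is_derive (fun s => beam a h (along x v s)) 0 (beam a (ddir v h) x).
Proof.
intros Hc Hh Ha.
pose proof (class_C_ddir 0 v h Hc) as Hdc.
pose proof (vanishes_far_ddir v h Hc Hh) as Hdh.
pose proof (class_C_continuous _ _ Hc) as Hcont.
pose proof (class_C_continuous _ _ Hdc) as Hdcont.
destruct (vanishes_along_near h x v a Hh Ha) as [T1 [HT10 HT1]].
destruct (vanishes_on_ray (ddir v h) x a Hdh Ha) as [T2 [_ HT2]].
set (T := Rmax T1 T2).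
pose proof (Rmax_l T1 T2 : T1 <= T); pose proof (Rmax_r T1 T2 : T2 <= T).
assert (Hswap : forall s t, along (along x v s) a t = along (along x a t) v s).
{ intros s t; unfold along; simpl; f_equal; ring. }
apply (is_derive_ext_loc (fun s => RInt (fun t => h (along (along x v s) a t)) 0 T)).
- apply locally_0_unit; intros s Hs.
  symmetry; apply int_0_infty_RInt; [now apply continuous_on_ray|].
  intros t Ht; apply HT1; lra.
- unfold beam; rewrite (int_0_infty_RInt _ T);
    [| now apply continuous_on_ray | intros; apply HT2; lra].
  rewrite (RInt_ext _ (fun t => ddir v h (along (along x v 0) a t)))
    by (intros; now rewrite along_0).
  apply (is_derive_under_RInt (fun s t => h (along (along x v s) a t))
           (fun s t => ddir v h (along (along x v s) a t))).
  + intros s t; rewrite Hswap.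
    apply (is_derive_ext (fun z => h (along (along x a t) v z)));
      [intros z; now rewrite Hswap | now apply is_derive_along_ddir].
  + continuity_rules.
  + intros s t; now apply continuous_on_ray.
Qed.

(** * The logarithmic potential in elliptic coordinates *)

(** From ln x = 2 ln (sqrt x) and - ln y <= 1 / y at y = sqrt x. *)
Lemma Rabs_mult_ln_le (x : R) : x <= 1 -> Rabs (x * ln x) <= 2 * sqrt x.
Proof.
intros Hx1; pose proof (sqrt_pos x) as Hs.
destruct (Rlt_or_le 0 x) as [Hx|Hx].
- assert (H0 : 0 < sqrt x) by now apply sqrt_lt_R0.
  assert (Hln : ln x = 2 * ln (sqrt x)).
  { rewrite <- (sqrt_sqrt x) at 1 by lra. rewrite ln_mult by easy; ring. }
  assert (Hle : - ln (sqrt x) <= / sqrt x).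
  { rewrite <- ln_Rinv by easy.
    pose proof (exp_ineq1_le (ln (/ sqrt x))) as E.
    rewrite exp_ln in E by now apply Rinv_0_lt_compat. lra. }
  assert (Hneg : ln x <= 0).
  { rewrite <- ln_1; apply ln_le; lra. }
  rewrite Rabs_left1 by nra.
  rewrite Hln; rewrite <- (sqrt_sqrt x) at 1 by lra.
  assert (sqrt x * - ln (sqrt x) <= 1).
  { apply (Rmult_le_compat_l (sqrt x)) in Hle; [|lra].
    rewrite Rinv_r in Hle; lra. }
  nra.
- (* [ln] takes the value 0 on the nonpositive reals *)
  replace (ln x) with 0; [rewrite Rmult_0_r, Rabs_R0; lra|].
  unfold ln; destruct (Rlt_dec 0 x); [exfalso; lra | easy].
Qed.

Lemma continuous_mult_ln (x : R) : 0 <= x -> continuous (fun r => r * ln r) x.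
Proof.
intros [Hx | <-].
- apply continuous_Rmult; [apply continuous_id | now apply continuous_ln].
- assert (Hsq : filterlim (fun r => 2 * sqrt r) (locally 0) (locally 0)).
  { replace 0 with (2 * sqrt 0) at 2 by (rewrite sqrt_0; ring).
    apply (continuous_Rmult _ (fun _ => 2) sqrt);
      [apply continuous_const | apply continuous_sqrt]. }
  unfold continuous; rewrite Rmult_0_l.
  apply (filterlim_le_le (fun r => - (2 * sqrt r)) _ (fun r => 2 * sqrt r) (Finite 0)).
  + apply locally_0_unit; intros t Ht; apply Rabs_le_between, Rabs_mult_ln_le.
    pose proof (Rle_abs t); lra.
  + simpl; replace 0 with (- 0) at 2 by ring.
    apply (filterlim_comp _ _ _ (fun r => 2 * sqrt r) Ropp) with (1 := Hsq).
    apply (filterlim_opp (V := R_NormedModule) 0).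
  + exact Hsq.
Qed.

Lemma continuous_under_RInt (f : R -> R -> R) (a b s : R) : a <= b ->
  (forall p : R * R, continuous (fun q => f (fst q) (snd q)) p) ->
  continuous (fun y => RInt (f y) a b) s.
Proof.
intros Hab Hf.
assert (Hc : forall y t, continuous (f y) t).
{ intros y t; apply (continuous_comp (fun t => (y, t)) (fun q => f (fst q) (snd q)));
    [continuity_rules | apply Hf]. }
apply filterlim_locally; intros eps.
assert (He : 0 < eps / (b - a + 1))
  by (apply Rdiv_lt_0_compat; [apply cond_pos | lra]).
destruct (uniform_continuity_2d_1d' f a b s
            (fun t _ => proj2 (continuity_2d_pt_filterlim f s t) (Hf (s, t)))
            (mkposreal _ He)) as [delta Hd].
exists delta; intros y Hy; change (Rabs (y - s) < delta) in Hy.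
change (Rabs (RInt (f y) a b - RInt (f s) a b) < eps).
replace (RInt (f y) a b - RInt (f s) a b) with (RInt (fun t => f y t - f s t) a b)
  by (apply (RInt_minus (f y) (f s)); now apply ex_RInt_cont).
apply Rle_lt_trans with ((b - a) * (eps / (b - a + 1))).
- apply abs_RInt_le_const; [easy | |].
  + apply (ex_RInt_minus (f y) (f s)); now apply ex_RInt_cont.
  + intros t Ht; apply Rlt_le, (Hd t s t y Ht); try easy;
      try (rewrite Rminus_diag, Rabs_R0; apply cond_pos);
      pose proof (cond_pos delta); apply Rabs_lt_between in Hy; lra.
- pose proof (cond_pos eps).
  replace (pos eps) with ((b - a + 1) * (eps / (b - a + 1))) at 2 by (field; lra).
  apply Rmult_lt_compat_r; [easy | lra].
Qed.

(** As [w] vanishes at [x], the difference quotient of the product is [k] times that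
    of [w]. This serves for k(r) = r ln r, which is not differentiable at 0. *)
Lemma is_derive_mult_zero (k w : R -> R) (x l : R) :
  continuous k x -> is_derive w x l -> w x = 0 ->
  is_derive (fun r => k r * w r) x (k x * l).
Proof.
intros Hk Hw H0; apply is_derive_Reals, uniqueness_step3.
apply is_derive_Reals, uniqueness_step2 in Hw.
assert (Hk' : limit1_in (fun h => k (x + h)) (fun h => h <> 0) (k x) 0).
{ intros eps Heps.
  destruct (proj1 (filterlim_locally k (k x)) Hk (mkposreal eps Heps)) as [delta Hd].
  exists delta; split; [apply cond_pos|]; intros h [_ Hh].
  apply Hd; change (Rabs (x + h - x) < delta).
  simpl in Hh; unfold Rdist in Hh; replace (x + h - x) with (h - 0) by ring; easy. }
eapply limit1_ext; [|exact (limit_mul _ _ _ _ _ _ Hk' Hw)].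
intros h Hh; simpl; rewrite H0; field; easy.
Qed.

Lemma ellipse_away_from_0 (p q t : R) : 0 < p -> 0 < q ->
  Rmin p q / 2 <= Rabs (p * cos t) \/ Rmin p q / 2 <= Rabs (q * sin t).
Proof.
intros Hp Hq; rewrite !Rabs_mult, (Rabs_pos_eq p), (Rabs_pos_eq q) by lra.
pose proof (Rmin_l p q); pose proof (Rmin_r p q).
pose proof (Rabs_pos (cos t)); pose proof (Rabs_pos (sin t)).
assert (Hs : Rabs (sin t) * Rabs (sin t) + Rabs (cos t) * Rabs (cos t) = 1).
{ rewrite <- !Rabs_mult, !Rabs_pos_eq by apply Rle_0_sqr; apply sin2_cos2. }
destruct (Rle_or_lt (/ 2) (Rabs (cos t))) as [Hc|Hc]; [left; nra | right].
assert (/ 2 <= Rabs (sin t)) by nra.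
nra.
Qed.

(** In the coordinates (r, theta) along ellipses with axes proportional to [p]
    and [q], the operator p^2 d_11 + q^2 d_22 becomes the polar Laplacian, whose
    angular part integrates to zero over a full turn.  In the proof [m], [w], [z] are
    the angular integrals of the field and of its first and second derivatives in r,
    and [H] is that of the source: r H = w + r z = (r m')'.  So r ln r H is the
    derivative of r ln r w - m. *)
Lemma log_potential (p q : R) (h : scalar_field) (x : point) :
  0 < p -> 0 < q -> class_C 2 h -> vanishes_far h ->
  int_0_infty (fun r => r * ln r *
    RInt (fun theta =>
      (fun y => p ^ 2 * partial ax1 (partial ax1 h) y
                + q ^ 2 * partial ax2 (partial ax2 h) y)
        (along x (p * cos theta, q * sin theta) r)) 0 (2 * PI))
  = 2 * PI * h x.
Proof.
intros Hp Hq Hh Hv.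
pose proof (partial_comm h Hh) as Hcomm.
pose proof (class_C_pred 1 h Hh) as Hh1.
pose proof (class_C_partial 1 ax1 h Hh) as Hx.
pose proof (class_C_partial 1 ax2 h Hh) as Hy.
pose proof (class_C_continuous _ _ Hh) as C0.
pose proof (class_C_continuous _ _ Hx) as C1.
pose proof (class_C_continuous _ _ Hy) as C2.
pose proof (class_C_continuous _ _ (class_C_partial 0 ax1 _ Hx)) as C11.
pose proof (class_C_continuous _ _ (class_C_partial 0 ax2 _ Hx)) as C12.
pose proof (class_C_continuous _ _ (class_C_partial 0 ax2 _ Hy)) as C22.
set (h1 := partial ax1 h) in *. set (h2 := partial ax2 h) in *.
set (h11 := partial ax1 h1) in *. set (h12 := partial ax2 h1) in *.
set (h22 := partial ax2 h2) in *.
pose (e := fun theta => (p * cos theta, q * sin theta)).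
pose (m0 := fun r t => h (along x (e t) r)).
pose (w0 := fun r t => (p * cos t) * h1 (along x (e t) r)
                     + (q * sin t) * h2 (along x (e t) r)).
pose (z0 := fun r t =>
  (p * cos t) * ((p * cos t) * h11 (along x (e t) r) + (q * sin t) * h12 (along x (e t) r))
  + (q * sin t) * ((p * cos t) * h12 (along x (e t) r) + (q * sin t) * h22 (along x (e t) r))).
pose (H0 := fun r t => p ^ 2 * h11 (along x (e t) r) + q ^ 2 * h22 (along x (e t) r)).
pose (m := fun r => RInt (m0 r) 0 (2 * PI)).
pose (w := fun r => RInt (w0 r) 0 (2 * PI)).
pose (z := fun r => RInt (z0 r) 0 (2 * PI)).
pose (H := fun r => RInt (H0 r) 0 (2 * PI)).
assert (Cm0 : forall r t, continuous (m0 r) t) by (unfold m0, e; continuity_rules).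
assert (Cw0 : forall r t, continuous (w0 r) t) by (unfold w0, e; continuity_rules).
assert (Cz0 : forall r t, continuous (z0 r) t) by (unfold z0, e; continuity_rules).
assert (CH0 : forall r t, continuous (H0 r) t) by (unfold H0, e; continuity_rules).
assert (Dm : forall r, is_derive m r (w r)).
{ intros r; apply (is_derive_under_RInt m0 w0).
  - intros s t; apply (is_derive_along h x (e t) s Hh1).
  - unfold w0, e; continuity_rules.
  - exact Cm0. }
assert (Dw : forall r, is_derive w r (z r)).
{ intros r; apply (is_derive_under_RInt w0 z0).
  - intros s t; unfold w0, z0.
    apply (is_derive_plus (fun s => p * cos t * h1 (along x (e t) s))
                          (fun s => q * sin t * h2 (along x (e t) s))).
    + apply (is_derive_scal (fun s => h1 (along x (e t) s)) s (p * cos t)).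
      apply (is_derive_along h1 x (e t) s Hx).
    + apply (is_derive_scal (fun s => h2 (along x (e t) s)) s (q * sin t)).
      pose proof (is_derive_along h2 x (e t) s Hy) as D; rewrite Hcomm in D; exact D.
  - unfold z0, e; continuity_rules.
  - exact Cw0. }
(* w + r z - r H is the integral over a full turn of the derivative in theta of the
   periodic function p sin theta h1 - q cos theta h2 *)
assert (Hang : forall r, r * H r = w r + r * z r).
{ intros r.
  assert (I0 : is_RInt (fun t => w0 r t + r * (z0 r t - H0 r t)) 0 (2 * PI) 0).
  { pose (F := fun t => (p * sin t) * h1 (along x (e t) r)
                        - (q * cos t) * h2 (along x (e t) r)).
    replace 0 with (F (2 * PI) - F 0) at 2
      by (unfold F, e; rewrite sin_2PI, cos_2PI, sin_0, cos_0; ring).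
    apply (is_RInt_minus_derive F).
    - intros t.
      assert (De : forall k, class_C 1 k ->
        is_derive (fun s => k (along x (e s) r)) t
          (partial ax1 k (along x (e t) r) * (- (r * p * sin t))
           + partial ax2 k (along x (e t) r) * (r * q * cos t))).
      { intros k Hk.
        apply (is_derive_field_comp k (fun s => fst x + r * (p * cos s))
                 (fun s => snd x + r * (q * sin s)) t); [easy | |];
          auto_derive; auto; ring. }
      pose proof (De h1 Hx) as D1; pose proof (De h2 Hy) as D2.
      fold h11 h12 in D1; fold h22 in D2; rewrite Hcomm in D2; fold h12 in D2.
      evar_last.
      + apply (is_derive_minus (fun t => p * sin t * h1 (along x (e t) r))
                 (fun t => q * cos t * h2 (along x (e t) r))).
        * apply (is_derive_mult (fun t => p * sin t) (fun t => h1 (along x (e t) r)) t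
                   (p * cos t)); [auto_derive; auto; ring | exact D1 | apply Rmult_comm].
        * apply (is_derive_mult (fun t => q * cos t) (fun t => h2 (along x (e t) r)) t
                   (- (q * sin t))); [auto_derive; auto; ring | exact D2 | apply Rmult_comm].
      + unfold minus, plus, opp, mult; simpl.
        pose proof (sin2_cos2 t) as Hsc; unfold Rsqr in Hsc.
        unfold w0, z0, H0.
        replace (p ^ 2 * h11 (along x (e t) r) + q ^ 2 * h22 (along x (e t) r))
          with ((sin t * sin t + cos t * cos t)
                * (p ^ 2 * h11 (along x (e t) r) + q ^ 2 * h22 (along x (e t) r)))
          by (rewrite Hsc; ring).
        ring.
    - unfold w0, z0, H0, e, Rminus; continuity_rules. }
  assert (I1 : is_RInt (fun t => w0 r t + r * (z0 r t - H0 r t)) 0 (2 * PI)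
                       (w r + r * (z r - H r))).
  { apply (is_RInt_plus (w0 r) (fun t => r * (z0 r t - H0 r t))).
    - now apply (RInt_correct (w0 r)), ex_RInt_cont.
    - apply (is_RInt_scal (fun t => z0 r t - H0 r t) 0 (2 * PI) r).
      apply (is_RInt_minus (z0 r) (H0 r));
        [apply (RInt_correct (z0 r)) | apply (RInt_correct (H0 r))];
        now apply ex_RInt_cont. }
  pose proof (is_RInt_unique (V := R_CompleteNormedModule) _ _ _ _ I0) as E0.
  pose proof (is_RInt_unique (V := R_CompleteNormedModule) _ _ _ _ I1) as E1.
  rewrite E0 in E1; lra. }
assert (Hm0 : m 0 = 2 * PI * h x).
{ unfold m; rewrite (RInt_ext _ (fun _ => h x)).
  - rewrite RInt_const; unfold scal; simpl; unfold mult; simpl; ring.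
  - intros t _; unfold m0; now rewrite along_0. }
assert (Hw0 : w 0 = 0) by (pose proof (Hang 0); lra).
assert (CH : forall r, continuous H r).
{ intros r; apply (continuous_under_RInt H0); [pose proof PI_RGT_0; lra|].
  unfold H0, e; continuity_rules. }
pose (F := fun r => (r * ln r) * w r - m r).
assert (DF : forall r, 0 <= r -> is_derive F r (r * ln r * H r)).
{ intros r Hr; unfold F; destruct Hr as [Hr | <-].
  - evar_last.
    + apply (is_derive_minus (fun r => r * ln r * w r) m); [|apply Dm].
      apply (is_derive_mult (fun r => r * ln r) w r (ln r + 1)); [ | apply Dw | apply Rmult_comm].
      auto_derive; [easy | field; lra].
    + unfold minus, plus, opp, mult; simpl.
      replace (r * ln r * H r) with (ln r * (r * H r)) by ring.
      rewrite Hang; ring.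
  - (* [w] vanishes at the centre, which absorbs the singular derivative of r ln r *)
    evar_last.
    + apply (is_derive_minus (fun r => r * ln r * w r) m); [|apply Dm].
      apply (is_derive_mult_zero (fun r => r * ln r) w 0 (z 0));
        [now apply continuous_mult_ln, Rle_refl | apply Dw | exact Hw0].
    + unfold minus, plus, opp; simpl; rewrite Hw0; ring. }
destruct (vanishes_along h Hv (Rabs (fst x) + Rabs (snd x)) (Rmin p q / 2))
  as [T [HT0 HT]].
{ unfold Rmin; destruct Rle_dec; lra. }
apply (int_0_infty_eventually _ (T + 1)); intros b Hb.
assert (Hfar : forall t r, T < r -> h (along x (e t) r) = 0).
{ pose proof (Rabs_pos (fst x)); pose proof (Rabs_pos (snd x)).
  intros t r Hr; apply HT; [lra | lra | now apply ellipse_away_from_0 | easy]. }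
assert (Hmb : forall r, T < r -> m r = 0).
{ intros r Hr; apply RInt_0_on; intros t _; now apply Hfar. }
assert (Hwb : w b = 0).
{ rewrite <- (is_derive_unique _ _ _ (Dm b)), <- (Derive_const 0 b).
  apply Derive_ext_loc; exists (mkposreal 1 Rlt_0_1); intros r Hr.
  change (Rabs (r - b) < 1) in Hr; apply Rabs_lt_between in Hr.
  apply Hmb; lra. }
replace (2 * PI * h x) with (F b - F 0)
  by (unfold F; rewrite Hmb, Hwb, Hw0, Hm0 by lra; ring).
change (is_RInt (fun r => r * ln r * H r) 0 b (F b - F 0)).
apply (is_RInt_derive F).
- intros r; rewrite Rmin_left by lra; intros [Hr _]; now apply DF.
- intros r; rewrite Rmin_left by lra; intros [Hr _].
  apply continuous_Rmult; [now apply continuous_mult_ln | apply CH].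
Qed.

(** * Solving the second order equation *)

Definition C_far (k : nat) (h : scalar_field) : Prop := class_C k h /\ vanishes_far h.

Lemma C_far_lin (k : nat) (c e : R) (h h' : scalar_field) :
  C_far k h -> C_far k h' -> C_far k (fun x => c * h x + e * h' x).
Proof. intros [] []; split; [now apply class_C_lin | now apply vanishes_far_lin]. Qed.

Lemma C_far_partial (k : nat) (i : axis) (h : scalar_field) :
  C_far (S k) h -> C_far k (partial i h).
Proof. intros []; split; [now apply class_C_partial | now apply vanishes_far_partial]. Qed.

Lemma C_far_pred (k : nat) (h : scalar_field) : C_far (S k) h -> C_far k h.
Proof. intros []; split; [now apply class_C_pred | easy]. Qed.

Lemma C_far_ddir (k : nat) (a : point) (h : scalar_field) :
  C_far (S k) h -> C_far k (ddir a h).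
Proof.
intros [Hh Hv]; split; [now apply class_C_ddir|].
apply vanishes_far_ddir; [now apply (class_C_S_1 k) | easy].
Qed.

Lemma partial_lin_C1 (i : axis) (c e : R) (h k : scalar_field) :
  class_C 1 h -> class_C 1 k ->
  partial i (fun x => c * h x + e * k x)
    = fun x => c * partial i h x + e * partial i k x.
Proof. intros Hh Hk; apply partial_lin; now apply (class_C_ex_partial 0). Qed.

Lemma ddir_ddir (a b : point) (h : scalar_field) : class_C 2 h ->
  ddir a (ddir b h) = fun x =>
    fst a * fst b * partial ax1 (partial ax1 h) x
    + (fst a * snd b + snd a * fst b) * partial ax1 (partial ax2 h) x
    + snd a * snd b * partial ax2 (partial ax2 h) x.
Proof.
intros Hh.
pose proof (fun i => class_C_partial 1 i h Hh) as Hp.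
rewrite (ddir_partial a) by now apply class_C_ddir.
rewrite (ddir_partial b) by now apply class_C_pred.
rewrite !partial_lin_C1 by apply Hp.
rewrite <- (partial_comm h Hh).
apply functional_extensionality; intros x; ring.
Qed.

Lemma beam_opp_ddir (a : point) (h : scalar_field) :
  C_far 1 h -> nonzero_dir a -> beam a (fun x => - ddir a h x) = h.
Proof.
intros Hh Ha.
assert (E : (fun x => - ddir a h x) = ddir a (fun x => (-1) * h x + 0 * h x)).
{ rewrite !ddir_partial, !partial_lin_C1; try apply Hh.
  - apply functional_extensionality; intros x; ring.
  - now apply C_far_lin. }
destruct (C_far_lin 1 (-1) 0 h h Hh Hh).
rewrite E, beam_ddir by easy.
apply functional_extensionality; intros x; ring.
Qed.

Lemma int_0_infty_second_derivative (c : R) (h : scalar_field) (x : point) :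
  C_far 2 h ->
  int_0_infty (fun t => t * (c * partial ax1 (partial ax1 h) (along x (1, 0) t)))
    = c * h x.
Proof.
intros Hh.
pose proof (C_far_pred _ _ Hh) as [Hh1 Hv].
destruct (C_far_partial 1 ax1 h Hh) as [Hx Hvx].
assert (Ha : nonzero_dir (1, 0)) by (left; apply R1_neq_R0).
destruct (vanishes_on_ray h x _ Hv Ha) as [T [_ HT]].
destruct (vanishes_on_ray _ x _ Hvx Ha) as [T' [_ HT']].
apply (int_0_infty_eventually _ (Rmax T T')); intros b Hb.
pose proof (Rmax_l T T'); pose proof (Rmax_r T T').
pose (F := fun t => c * (t * partial ax1 h (along x (1, 0) t) - h (along x (1, 0) t))).
replace (c * h x) with (F b - F 0)
  by (unfold F; rewrite along_0, HT, HT' by lra; ring).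
apply (is_RInt_minus_derive F).
- intros t; evar_last.
  + apply is_derive_scal, @is_derive_minus; [|apply (is_derive_along h); exact Hh1].
    apply (is_derive_mult (fun t => t) (fun t => partial ax1 h (along x (1, 0) t)));
      [apply is_derive_id | apply is_derive_along, Hx | apply Rmult_comm].
  + unfold minus, plus, opp, mult, one; simpl; ring.
- pose proof (class_C_continuous _ _ (class_C_partial 0 ax1 _ Hx)).
  continuity_rules.
Qed.

(** [solve u] inverts the operator in all three regimes: by two integrations
    along characteristics, by Taylor's formula with integral remainder, or by the
    logarithmic potential. *)
Lemma solve_correct (u : point) (h : scalar_field) :
  fst u <> 0 -> C_far 2 h ->
  solve u (fun x => 2 * fst u ^ 2 * partial ax1 (partial ax1 h) x
                    + (fst u ^ 2 - snd u ^ 2) * partial ax2 (partial ax2 h) x) = h.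
Proof.
intros Hu Hh; apply functional_extensionality; intros x; unfold solve.
assert (HA : 0 < 2 * fst u ^ 2) by nra.
set (A := 2 * fst u ^ 2) in *; set (B := fst u ^ 2 - snd u ^ 2).
destruct total_order_T as [[HB | HB] | HB].
- assert (Hn : forall s, nonzero_dir (sqrt A, s))
    by (left; simpl; apply Rgt_not_eq, sqrt_lt_R0, HA).
  replace (fun y => A * partial ax1 (partial ax1 h) y + B * partial ax2 (partial ax2 h) y)
    with (ddir (sqrt A, - sqrt (- B)) (ddir (sqrt A, sqrt (- B)) h)).
  + destruct (C_far_ddir 1 (sqrt A, sqrt (- B)) h Hh).
    rewrite beam_ddir, beam_opp_ddir by (try apply Hn; try easy; now apply C_far_pred).
    reflexivity.
  + rewrite ddir_ddir by apply Hh; apply functional_extensionality; intros y; simpl.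
    rewrite sqrt_sqrt by lra.
    replace (- sqrt (- B) * sqrt (- B)) with (- (sqrt (- B) * sqrt (- B))) by ring.
    rewrite sqrt_sqrt by lra; ring.
- transitivity (/ A * (A * h x)); [|field; lra].
  rewrite <- int_0_infty_second_derivative by easy.
  do 2 f_equal; apply functional_extensionality; intros t; rewrite HB; ring.
- pose proof (log_potential (sqrt A) (sqrt B) h x (sqrt_lt_R0 _ HA) (sqrt_lt_R0 _ HB)
                (proj1 Hh) (proj2 Hh)) as E.
  rewrite !pow2_sqrt in E by lra; rewrite E.
  field; apply PI_neq0.
Qed.

(** * The V-line transforms of the two kinds of fields *)

Lemma nonzero_dir_mirror (u : point) : nonzero_dir u -> nonzero_dir (mirror u).
Proof. unfold nonzero_dir, mirror; simpl; lra. Qed.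

(** The derivative along one branch annihilates the beam along that branch up to a
    local term, and commutes with the other beam; so the two derivatives together
    turn a V-line transform into a differential expression. *)
Lemma ddir_ddir_vline (u v : point) (phi psi : scalar_field) :
  nonzero_dir u -> nonzero_dir v -> C_far 1 phi -> C_far 1 psi ->
  ddir u (ddir v (fun x => beam u phi x + beam v psi x))
    = fun x => - (ddir v phi x + ddir u psi x).
Proof.
intros Hu Hv [Hp Hp'] [Hq Hq'].
assert (E : ddir v (fun x => beam u phi x + beam v psi x)
            = fun x => beam u (ddir v phi) x + - psi x).
{ apply functional_extensionality; intros x; apply ddir_is_derive.
  apply (is_derive_plus (fun t => beam u phi (along x v t))
                        (fun t => beam v psi (along x v t))).
  - now apply is_derive_beam_other.
  - apply is_derive_beam_same; auto; apply (class_C_continuous 1), Hq. }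
rewrite E; apply functional_extensionality; intros x; apply ddir_is_derive.
replace (- (ddir v phi x + ddir u psi x))
  with (- ddir v phi x + - ddir u psi x) by ring.
apply (is_derive_plus (fun t => beam u (ddir v phi) (along x u t))
                      (fun t => - psi (along x u t))).
- apply is_derive_beam_same; auto.
  + apply (class_C_continuous 0), class_C_ddir, Hp.
  + now apply vanishes_far_ddir.
- apply (is_derive_opp (fun t => psi (along x u t))).
  pose proof (is_derive_along_ddir psi x u 0 Hq) as D; now rewrite along_0 in D.
Qed.

Definition entry (f : tensor_field) (i j : axis) : scalar_field := fun x => f x i j.

Lemma contract_entries (f : tensor_field) (tau : tensor) :
  contract f tau = fun x =>
    1 * (tau ax1 ax1 * entry f ax1 ax1 x + tau ax2 ax2 * entry f ax2 ax2 x)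
    + 2 * tau ax1 ax2 * entry f ax1 ax2 x.
Proof.
apply functional_extensionality; intros x; unfold contract, inner, entry; ring.
Qed.

Lemma ddir_contract (f : tensor_field) (tau : tensor) (a : point) :
  (forall i j, C_far 1 (entry f i j)) ->
  ddir a (contract f tau) = fun x => contract (fun y i j => ddir a (entry f i j) y) tau x.
Proof.
intros Hf.
apply functional_extensionality; intros x; apply ddir_is_derive.
pose (E := fun i j t => entry f i j (along x a t)).
assert (HE : forall t, tau ax1 ax1 * E ax1 ax1 t
                       + (2 * tau ax1 ax2 * E ax1 ax2 t + tau ax2 ax2 * E ax2 ax2 t)
                       = contract f tau (along x a t))
  by (intros t; unfold E, entry, contract, inner; ring).
apply (is_derive_ext _ _ _ _ HE).
assert (D : forall i j, is_derive (E i j) 0 (ddir a (entry f i j) x)).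
{ intros i j; pose proof (is_derive_along_ddir _ x a 0 (proj1 (Hf i j))) as D.
  now rewrite along_0 in D. }
evar_last.
- apply @is_derive_plus; [|apply @is_derive_plus]; apply is_derive_scal, D.
- unfold contract, inner, plus; simpl; ring.
Qed.

Lemma C_far_contract (k : nat) (f : tensor_field) (tau : tensor) :
  (forall i j, C_far k (entry f i j)) -> C_far k (contract f tau).
Proof.
intros Hf; rewrite contract_entries; apply C_far_lin; [apply C_far_lin|]; apply Hf.
Qed.

(** Contraction with the product of a direction and its normal is
    u_1 u_2 (f_22 - f_11) + (u_1^2 - u_2^2) f_12 for [u]; for [mirror u] the first
    term changes sign.  The two derivatives thus keep only d_1 of f_22 - f_11 and d_2
    of f_12. *)
Lemma ddir_ddir_Mtrans (u : point) (f : tensor_field) :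
  nonzero_dir u -> (forall i j, C_far 1 (entry f i j)) ->
  ddir u (ddir (mirror u) (Mtrans u f)) = fun x =>
    snd u * (2 * fst u ^ 2 * (partial ax1 (entry f ax2 ax2) x
                              - partial ax1 (entry f ax1 ax1) x)
             - 2 * (fst u ^ 2 - snd u ^ 2) * partial ax2 (entry f ax1 ax2) x).
Proof.
intros Hu Hf; unfold Mtrans.
rewrite ddir_ddir_vline; auto using nonzero_dir_mirror, C_far_contract.
rewrite !ddir_contract by easy.
apply functional_extensionality; intros x; unfold contract, inner.
rewrite !ddir_partial by apply Hf.
unfold sym_prod, perp, mirror; simpl; field.
Qed.

Lemma C2c_field_component (r : R) (g : vector_field) :
  C2c_field r g -> forall i, C_far 2 (component i g).
Proof. intros Hg i; split; [apply Hg | apply (C2c_vanishes_far r), Hg]. Qed.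

Lemma tensor_field_ext (f f' : tensor_field) : (forall x i j, f x i j = f' x i j) -> f = f'.
Proof.
intros E; apply functional_extensionality; intros x.
apply functional_extensionality; intros i.
apply functional_extensionality; intros j; apply E.
Qed.

Lemma entry_d (g : vector_field) (i j : axis) :
  entry (d g) i j = fun x => / 2 * partial j (component i g) x
                             + / 2 * partial i (component j g) x.
Proof. apply functional_extensionality; intros x; unfold entry, d; ring. Qed.

Lemma entry_dperp (g : vector_field) (i j : axis) :
  entry (dperp g) i j = fun x =>
    / 2 * (-1) ^ Defs.num j * partial (other j) (component i g) x
    + / 2 * (-1) ^ Defs.num i * partial (other i) (component j g) x.
Proof. apply functional_extensionality; intros x; unfold entry, dperp; ring. Qed.

(** Contracted with a^2, the field d g is the derivative along [a] of a . g, and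
    the beam transform along [a] undoes that derivative. *)
Lemma beam_contract_d (g : vector_field) (a : point) :
  (forall i, C_far 1 (component i g)) -> nonzero_dir a ->
  beam a (contract (d g) (sq a)) = fun x =>
    - (fst a * component ax1 g x + snd a * component ax2 g x).
Proof.
intros Hg Ha.
destruct (C_far_lin 1 (fst a) (snd a) _ _ (Hg ax1) (Hg ax2)) as [Hc Hv].
rewrite <- (beam_ddir a _ Hc Hv Ha); f_equal.
rewrite ddir_partial, !partial_lin_C1 by (exact Hc || apply Hg).
apply functional_extensionality; intros x.
unfold contract, inner, d, sq, sym_prod; simpl; field.
Qed.

(** The field d^perp g contracted with the square of a^perp is the derivative along
    [a] of a^perp . g. *)
Lemma beam_contract_dperp (g : vector_field) (a : point) :
  (forall i, C_far 1 (component i g)) -> nonzero_dir a ->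
  beam a (contract (dperp g) (sq (perp a))) = fun x =>
    - (- snd a * component ax1 g x + fst a * component ax2 g x).
Proof.
intros Hg Ha.
destruct (C_far_lin 1 (- snd a) (fst a) _ _ (Hg ax1) (Hg ax2)) as [Hc Hv].
rewrite <- (beam_ddir a _ Hc Hv Ha); f_equal.
rewrite ddir_partial, !partial_lin_C1 by (exact Hc || apply Hg).
apply functional_extensionality; intros x.
unfold contract, inner, dperp, sq, sym_prod, perp; simpl; field.
Qed.

(** * Recovery of the fields *)

Lemma recover_d_correct (u : point) (g : vector_field) :
  unit_vector u -> fst u <> 0 -> snd u <> 0 -> (forall i, C_far 2 (component i g)) ->
  recover_d u (Ltrans u (d g)) (Mtrans u (d g)) = d g.
Proof.
unfold unit_vector; intros Hu H1 H2 Hg.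
assert (Hn : nonzero_dir u) by now left.
pose proof (fun i => C_far_pred 1 _ (Hg i)) as Hg1.
pose proof (fun i j => C_far_partial 1 i _ (Hg j)) as Hp.
assert (EL : (fun x => - Ltrans u (d g) x / (2 * snd u)) = component ax2 g).
{ apply functional_extensionality; intros x; unfold Ltrans.
  rewrite !beam_contract_d by auto using nonzero_dir_mirror.
  unfold mirror; simpl; field; easy. }
assert (EM : solve u (fun x => partial ax1 (partial ax2 (component ax2 g)) x
             - ddir u (ddir (mirror u) (Mtrans u (d g))) x / snd u)
             = component ax1 g).
{ rewrite <- (solve_correct u (component ax1 g)) by easy; f_equal.
  rewrite ddir_ddir_Mtrans; [|easy|].
  2: { intros i j; rewrite entry_d; apply C_far_lin; apply Hp. }
  rewrite !entry_d, !partial_lin_C1 by apply Hp.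
  rewrite <- (partial_comm (component ax2 g)) by apply Hg.
  apply functional_extensionality; intros x.
  (* in D_u D_v M f / u_2, the coefficient of d_12 g_2 is A - B = u_1^2 + u_2^2 = 1 *)
  replace (fst u ^ 2) with (1 - snd u ^ 2) by lra.
  field; easy. }
assert (E : forall g2, g2 = component ax2 g ->
  d (fun x => (solve u (fun x => partial ax1 (partial ax2 g2) x
    - ddir u (ddir (mirror u) (Mtrans u (d g))) x / snd u) x, g2 x)) = d g).
{ intros g2 ->; rewrite EM; apply tensor_field_ext; intros x i j; now destruct i, j. }
exact (E _ EL).
Qed.

Lemma recover_dperp_correct (u : point) (g : vector_field) :
  unit_vector u -> fst u <> 0 -> snd u <> 0 -> (forall i, C_far 2 (component i g)) ->
  recover_dperp u (Ttrans u (dperp g)) (Mtrans u (dperp g)) = dperp g.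
Proof.
unfold unit_vector; intros Hu H1 H2 Hg.
assert (Hn : nonzero_dir u) by now left.
pose proof (fun i => C_far_pred 1 _ (Hg i)) as Hg1.
pose proof (fun i j => C_far_partial 1 i _ (Hg j)) as Hp.
assert (ET : (fun x => Ttrans u (dperp g) x / (2 * snd u)) = component ax1 g).
{ apply functional_extensionality; intros x; unfold Ttrans.
  rewrite !beam_contract_dperp by auto using nonzero_dir_mirror.
  unfold mirror; simpl; field; easy. }
assert (EM : solve u (fun x => ddir u (ddir (mirror u) (Mtrans u (dperp g))) x / snd u
             - partial ax1 (partial ax2 (component ax1 g)) x)
             = component ax2 g).
{ rewrite <- (solve_correct u (component ax2 g)) by easy; f_equal.
  rewrite ddir_ddir_Mtrans; [|easy|].
  2: { intros i j; rewrite entry_dperp; apply C_far_lin; apply Hp. }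
  rewrite !entry_dperp, !partial_lin_C1 by apply Hp.
  simpl (other _); simpl (Defs.num _).
  rewrite <- (partial_comm (component ax1 g)) by apply Hg.
  apply functional_extensionality; intros x.
  (* in D_u D_v M f / u_2, the coefficient of d_12 g_1 is A - B = u_1^2 + u_2^2 = 1 *)
  replace (fst u ^ 2) with (1 - snd u ^ 2) by lra.
  field; easy. }
assert (E : forall g1, g1 = component ax1 g ->
  dperp (fun x => (g1 x, solve u (fun x =>
    ddir u (ddir (mirror u) (Mtrans u (dperp g))) x / snd u
    - partial ax1 (partial ax2 g1) x) x)) = dperp g).
{ intros g1 ->; rewrite EM; apply tensor_field_ext; intros x i j; now destruct i, j. }
exact (E _ ET).
Qed.

Lemma lin_indep_mirror (u : point) :
  lin_indep u (mirror u) -> fst u <> 0 /\ snd u <> 0.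
Proof.
unfold lin_indep, mirror; simpl; intros H.
split; intros E; rewrite E in H.
- destruct (H 1 (-1)); lra.
- destruct (H 1 1); lra.
Qed.

(** Injectivity is formal once a left inverse depends on the values of the data
    alone; the data of a field and of its normal form op g coincide because equal
    entries make equal fields. *)
Lemma recovery_unique (op : vector_field -> tensor_field) (r : R)
  (rec : scalar_field -> scalar_field -> tensor_field)
  (X Y : tensor_field -> scalar_field) :
  (forall g, C2c_field r g -> rec (X (op g)) (Y (op g)) = op g) ->
  (forall f, of_form op r f -> forall x i j, f x i j = rec (X f) (Y f) x i j) /\
  (forall f f', of_form op r f -> of_form op r f' ->
     (forall x, X f x = X f' x) -> (forall x, Y f x = Y f' x) ->
     forall x i j, f x i j = f' x i j).
Proof.
intros Hrec.
assert (H : forall f, of_form op r f -> rec (X f) (Y f) = f).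
{ intros f [g [Hg Hf]].
  replace f with (op g) by (apply tensor_field_ext; intros; now rewrite Hf).
  now apply Hrec. }
split.
- intros f Hf x i j; now rewrite H.
- intros f f' Hf Hf' HX HY x i j.
  rewrite <- (H f Hf), <- (H f' Hf').
  now rewrite (functional_extensionality _ _ HX), (functional_extensionality _ _ HY).
Qed.

Theorem theorem4 (r1 : R) (u : point) (Hr1 : 0 < r1)
  (Hu : unit_vector u) (Huv : lin_indep u (mirror u)) :
  ((forall f : tensor_field, of_form d r1 f ->
      forall x i j, f x i j = recover_d u (Ltrans u f) (Mtrans u f) x i j) /\
   (forall f f' : tensor_field, of_form d r1 f -> of_form d r1 f' ->
      (forall x, Ltrans u f x = Ltrans u f' x) ->
      (forall x, Mtrans u f x = Mtrans u f' x) ->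
      forall x i j, f x i j = f' x i j)) /\
  ((forall f : tensor_field, of_form dperp r1 f ->
      forall x i j, f x i j = recover_dperp u (Ttrans u f) (Mtrans u f) x i j) /\
   (forall f f' : tensor_field, of_form dperp r1 f -> of_form dperp r1 f' ->
      (forall x, Ttrans u f x = Ttrans u f' x) ->
      (forall x, Mtrans u f x = Mtrans u f' x) ->
      forall x i j, f x i j = f' x i j)).
Proof.
destruct (lin_indep_mirror u Huv) as [H1 H2].
split.
- apply (recovery_unique d r1 (recover_d u) (Ltrans u) (Mtrans u)).
  intros g Hg; apply recover_d_correct; auto; now apply (C2c_field_component r1).
- apply (recovery_unique dperp r1 (recover_dperp u) (Ttrans u) (Mtrans u)).
  intros g Hg; apply recover_dperp_correct; auto; now apply (C2c_field_component r1).
Qed.
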